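(* Let $C$, $f_0$, $\tau$, $\{\pi_\theta\}_{\theta\in\Theta}$, $Z$, $F$, $\rho_\theta$ and $w$ be as in the context. Suppose that the family $\{\pi_\theta\}_{\theta\in\Theta}$ is strictly positive on $C$, twice continuously differentiable in $\theta$, and such that differentiation under the integral sign is valid for $Z(\theta)$ up to second order. Then $$\nabla F(\theta)=-\tau\,\mathbb{E}_{\rho_\theta}\left[\nabla_\theta\log\pi_\theta(u)\right]=-\tau\,\frac{\mathbb{E}_{\pi_\theta}\left[w(u)\nabla_\theta\log\pi_\theta(u)\right]}{\mathbb{E}_{\pi_\theta}\left[w(u)\right]},$$ where $w(u):=\exp(-f_0(u)/\tau)\,\mathbf{1}_C(u)$. In addition, $$\nabla^2F(\theta)=-\tau\Big(\mathbb{E}_{\rho_\theta}\left[\nabla_\theta^2\log\pi_\theta(u)\right]+\operatorname{Cov}_{\rho_\theta}\left(\nabla_\theta\log\pi_\theta(u)\right)\Big).$$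
   Context: $C\subset\mathbb{R}^m$ is a nonempty compact set (of feasible control sequences), $f_0$ is a continuous real-valued objective, and $\tau>0$ is a regularization parameter. $\Theta\subseteq\mathbb{R}^p$ is a parameter space and, for each $\theta\in\Theta$, $\pi_\theta$ is a probability density on $\mathbb{R}^m$ (the sampling distribution). $\mathbf{1}_C$ is the indicator function of $C$. Define $$Z(\theta):=\int_C\pi_\theta(u)e^{-f_0(u)/\tau}\,du,\qquad F(\theta):=-\tau\log Z(\theta),$$ where $Z(\theta)>0$ since $\pi_\theta$ is positive on $C$, and the truncated Gibbs tilt $$\rho_\theta(u):=\frac{\pi_\theta(u)\exp(-f_0(u)/\tau)\mathbf{1}_C(u)}{Z(\theta)}.$$ $\mathbb{E}_\pi$ and $\operatorname{Cov}_\pi$ denote expectation and covariance under the density $\pi$.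
   Formalization: The Hessian formula is stated at interior θ where ∇_θ log π_θ has finite second moments under ρ_θ, i.e. where the covariance exists; the listed hypotheses alone allow an infinite covariance, leaving the right-hand side undefined. Derivatives are taken at interior points of Θ. *)

(* Defs.v *)
From HB Require Import structures.
From mathcomp Require Import all_boot all_order all_algebra.
From mathcomp Require Import all_classical all_reals all_analysis.
From mathcomp Require Import measurable_realfun.

Set Implicit Arguments.
Unset Strict Implicit.
Unset Printing Implicit Defensive.

Import Order.TTheory GRing.Theory Num.Theory.
Import numFieldNormedType.Exports.

Local Open Scope classical_set_scope.
Local Open Scope ring_scope.

Notation borel_rV R n := (g_sigma_algebraType (@open 'rV[R]_n)).

Lemma open_measurable_rV (R : realType) (n : nat) (U : set 'rV[R]_n) :
  open U -> measurable (U : set (borel_rV R n)).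
Proof. by move=> oU; exact: sub_sigma_algebra. Qed.

Lemma compact_measurable_rV (R : realType) (n : nat) (K : set 'rV[R]_n) :
  compact K -> measurable (K : set (borel_rV R n)).
Proof.
move=> cK; rewrite -[K]setCK; apply: measurableC; apply: open_measurable_rV.
by apply: closed_openC; apply: compact_closed => //; exact: norm_hausdorff.
Qed.

Lemma measurable_coord_rV (R : realType) (n : nat) (i : 'I_n) :
  measurable_fun [set: borel_rV R n] (fun v => v ord0 i : R).
Proof.
apply: (measurability _ (RGenInftyO.measurableE R)).
move=> _ [_ [x ->] <-]; rewrite setTI; apply: open_measurable_rV.
apply: open_comp; last exact: interval_open.
by move=> v _; exact: coord_continuous.
Qed.

Lemma open_bigcup_ratbox (R : realType) (n : nat) (U : set 'rV[R]_n) :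
  open U ->
  U = \bigcup_(q in [set q : 'rV[rat]_n * 'rV[rat]_n |
        [set v : 'rV[R]_n | forall i,
           v ord0 i \in `]ratr (q.1 ord0 i), ratr (q.2 ord0 i)[] `<=` U])
      [set v : 'rV[R]_n | forall i,
           v ord0 i \in `]ratr (q.1 ord0 i), ratr (q.2 ord0 i)[].
Proof.
move=> oU; apply/seteqP; split => [x Ux|x [q /= qU qx]]; last exact: qU.
have /nbhs_ballP[e /= e0 xeU] : nbhs x U by exact: open_nbhs_nbhs.
have /choice[a ax] (i : 'I_n) :
    exists q : rat, ratr q \in `]x ord0 i - e, x ord0 i[.
  by apply: rat_in_itvoo; rewrite ltrBlDr ltrDl.
have /choice[b bx] (i : 'I_n) :
    exists q : rat, ratr q \in `]x ord0 i, x ord0 i + e[.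
  by apply: rat_in_itvoo; rewrite ltrDl.
exists (\row_i a i, \row_i b i) => /= [v vab|i]; last first.
  rewrite !mxE in_itv/=; move: (ax i) (bx i); rewrite !in_itv/=.
  by move=> /andP[_ ->] /andP[->].
apply: xeU; split => // i0 i; rewrite (ord1 i0).
have := vab i; rewrite !mxE.
move: (ax i) (bx i); rewrite !in_itv/= => /andP[xa _] /andP[_ xb] /andP[av vb].
rewrite /ball/= ltr_norml; apply/andP; split.
  by rewrite ltrBrDl ltrBlDr (lt_trans vb).
by rewrite ltrBlDr -ltrBlDl (lt_trans xa).
Qed.

Lemma measurable_fun_rVP d (T : measurableType d) (R : realType) (n : nat)
    (f : T -> borel_rV R n) :
  (forall i, measurable_fun [set: T] (fun t => f t ord0 i : R)) ->
  measurable_fun [set: T] f.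
Proof.
move=> mf.
apply: (@measurability d _ T (borel_rV R n) setT f (@open 'rV[R]_n) erefl).
move=> _ [U oU <-]; rewrite setTI (open_bigcup_ratbox oU) preimage_bigcup.
rewrite bigcup_mkcond; apply: countable_bigcupT_measurable => // q.
case: ifPn => // _.
rewrite (_ : _ @^-1` _ = \bigcap_(i in [set: 'I_n])
   (fun t => f t ord0 i : R) @^-1` `]ratr (q.1 ord0 i), ratr (q.2 ord0 i)[%classic).
  apply: fin_bigcap_measurable => // i _.
  by rewrite -[X in measurable X]setTI; exact: mf.
by apply/seteqP; split => t /= h i //=; have := h i; rewrite ?in_itv//=; exact.
Qed.

(** Lebesgue measure on R^n: the point mass for n = 0, and the image of
    lebesgue_measure \x (Lebesgue measure on R^n) under (x, v) |-> (x, v_1,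
    ..., v_n) for n.+1. *)
Section lebesgue_rV_step.
Variables (R : realType) (n : nat).

Definition rV_cons (xv : measurableTypeR R * borel_rV R n) : borel_rV R n.+1 :=
  row_mx (const_mx xv.1 : 'rV[R]_1) xv.2.

Lemma measurable_rV_cons :
  measurable_fun [set: measurableTypeR R * borel_rV R n] rV_cons.
Proof.
apply: measurable_fun_rVP => i; case: (@split_ordP 1 n i) => j ->.
  rewrite (_ : (fun _ => _) = fst); first exact: measurable_fst.
  by apply/funext => xv; apply: etrans (row_mxEl _ _ _ _) _; rewrite mxE.
rewrite (_ : (fun _ => _) = (fun v : borel_rV R n => v ord0 j : R) \o snd).
  apply: measurableT_comp; [exact: measurable_coord_rV|exact: measurable_snd].
by apply/funext => xv; exact: row_mxEr.
Qed.

Definition rV_uncons (v : borel_rV R n.+1) : measurableTypeR R * borel_rV R n :=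
  (v ord0 ord0, rsubmx (v : 'rV[R]_(1 + n))).

Lemma rV_consK : cancel rV_cons rV_uncons.
Proof.
case=> x v; rewrite /rV_uncons /rV_cons row_mxKr/=; congr pair.
have -> : ord0 = lshift n (ord0 : 'I_1) by exact/val_inj.
by apply: etrans (row_mxEl _ _ _ _) _; rewrite mxE.
Qed.

Lemma measurable_rV_uncons :
  measurable_fun [set: borel_rV R n.+1] rV_uncons.
Proof.
apply: measurable_fun_pair; first exact: measurable_coord_rV.
apply: measurable_fun_rVP => i.
rewrite (_ : (fun _ => _) =
  fun v : borel_rV R n.+1 => v ord0 (rshift 1 i) : R).
  exact: measurable_coord_rV.
by apply/funext => v; rewrite mxE.
Qed.

Variable mu : {sigma_finite_measure set (borel_rV R n) -> \bar R}.

Definition lebesgue_step : set (borel_rV R n.+1) -> \bar R :=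
  pushforward (@lebesgue_measure R \x mu)%E rV_cons.

Let lebesgue_step0 : lebesgue_step set0 = 0%E.
Proof. by rewrite /lebesgue_step /pushforward preimage_set0 measure0. Qed.

Let lebesgue_step_ge0 A : (0 <= lebesgue_step A)%E.
Proof. have mc := measurable_rV_cons; exact: measure_ge0. Qed.

Let lebesgue_step_sigma_additive : semi_sigma_additive lebesgue_step.
Proof.
have mc := measurable_rV_cons; exact: measure_semi_sigma_additive.
Qed.

HB.instance Definition _ := isMeasure.Build _ _ _ lebesgue_step
  lebesgue_step0 lebesgue_step_ge0 lebesgue_step_sigma_additive.

Let lebesgue_step_sigma_finite : sigma_finite setT lebesgue_step.
Proof.
have [F TF Foo] : sigma_finite setT (@lebesgue_measure R \x mu)%E.
  have /sigma_finiteP[F [TF ndF Foo]] := sigma_finiteT (@lebesgue_measure R).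
  have /sigma_finiteP[G [TG ndG Goo]] := sigma_finiteT mu.
  exists (fun k => F k `*` G k) => [|k].
    rewrite -setXTT TF TG; apply/seteqP; split => -[x y] /=.
      move=> [[k _ Fkx] [l _ Gly]]; exists (maxn k l) => //; split.
        by move: x Fkx; exact/subsetPset/ndF/leq_maxl.
      by move: y Gly; exact/subsetPset/ndG/leq_maxr.
    by move=> [k _ [Fkx Gky]]; split; exists k.
  have [mF Fk] := Foo k; have [mG Gk] := Goo k.
  split; first exact: measurableX.
  by rewrite product_measure1E// lte_mul_pinfty// ge0_fin_numE.
exists (fun k => rV_uncons @^-1` F k) => [|k].
  by rewrite -preimage_bigcup -TF preimage_setT.
have [mF Fk] := Foo k; split.
  by rewrite -[X in measurable X]setTI; exact: measurable_rV_uncons.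
rewrite /lebesgue_step /pushforward.
by rewrite (_ : rV_cons @^-1` _ = F k)//; apply/seteqP; split => x /=;
  rewrite rV_consK.
Qed.

HB.instance Definition _ := @Measure_isSigmaFinite.Build _ _ _ lebesgue_step
  lebesgue_step_sigma_finite.

End lebesgue_rV_step.

Fixpoint lebesgue_rV (R : realType) (n : nat) :
    {sigma_finite_measure set (borel_rV R n) -> \bar R} :=
  match n with
  | 0 => dirac (0 : borel_rV R 0)
  | k.+1 => lebesgue_step (lebesgue_rV R k)
  end.

Lemma lebesgue_rV_prod (R : realType) (n : nat) (A : 'I_n -> set R) :
  (forall i, measurable (A i)) ->
  (lebesgue_rV R n [set v : 'rV[R]_n | forall i, A i (v ord0 i)] =
   \prod_(i < n) lebesgue_measure (A i))%E.
Proof.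
elim: n A => [|n IHn] A mA.
  by rewrite big_ord0 /= diracE mem_set// => -[].
rewrite big_ord_recl -IHn//= /lebesgue_step /pushforward.
rewrite -product_measure1E; [|exact: mA|]; last first.
  rewrite (_ : [set v | _] = \bigcap_(i in [set: 'I_n])
     (fun v : borel_rV R n => v ord0 i : R) @^-1` A (lift ord0 i)).
    apply: fin_bigcap_measurable => // i _.
    by rewrite -[X in measurable X]setTI; exact: measurable_coord_rV.
  by apply/seteqP; split => v /= h i; [move=> _|]; exact: h.
congr (product_measure1 _ _ _); apply/seteqP; split => -[x v] /=.
  move=> h; split.
    have := h ord0; rewrite (_ : _ ord0 ord0 = x)//.
    have -> : (ord0 : 'I_n.+1) = lshift n (ord0 : 'I_1) by exact/val_inj.
    by apply: etrans (row_mxEl _ _ _ _) _; rewrite mxE.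
  move=> i; have := h (lift ord0 i).
  rewrite (_ : _ (lift ord0 i) = v ord0 i)//.
  have -> : lift ord0 i = rshift 1 i by exact/val_inj.
  exact: row_mxEr.
move=> [Ax Av] i; case: (@split_ordP 1 n i) => j ->.
  rewrite (_ : _ (lshift n j) = x); last first.
    by apply: etrans (row_mxEl _ _ _ _) _; rewrite mxE.
  by rewrite (_ : lshift n j = ord0)//; apply/val_inj; rewrite (ord1 j).
rewrite (_ : _ (rshift 1 j) = v ord0 j); last exact: row_mxEr.
by rewrite (_ : rshift 1 j = lift ord0 j)//; exact/val_inj.
Qed.

Section differential_calculus.
Variables (R : realType) (p : nat).
Implicit Types (f : 'rV[R]_p -> R) (U : set 'rV[R]_p).

Definition gradient f (x : 'rV[R]_p) : 'rV[R]_p :=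
  \row_i 'D_(delta_mx 0 i) f x.

Definition hessian f (x : 'rV[R]_p) : 'M[R]_p :=
  \matrix_(i, j) 'D_(delta_mx 0 i) ('D_(delta_mx 0 j) f) x.

(** Only meaningful for [U] open: derivatives are two-sided. *)
Definition C2_on U f :=
  forall x, U x ->
  [/\ differentiable f x, differentiable (gradient f) x &
      {for x, continuous (hessian f)}].

End differential_calculus.

(** Validity of the interchange, with no domination condition; integrability
    is part of it because [Rintegral] is total. *)
Section differentiation_under_integral.
Variables (R : realType) (p : nat) (d : measure_display).
Variables (T : measurableType d) (mu : {measure set T -> \bar R}).
Variables (C : set T) (q : 'rV[R]_p -> T -> R) (U : set 'rV[R]_p).

Let I (t : 'rV[R]_p) : R := \int[mu]_(u in C) q t u.

Definition diff_under_integral1 := forall t, U t ->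
  [/\ differentiable I t,
      forall i, mu.-integrable C (fun u => (gradient (q ^~ u) t 0 i)%:E) &
      gradient I t = \row_i \int[mu]_(u in C) gradient (q ^~ u) t 0 i].

Definition diff_under_integral2 := forall t, U t ->
  [/\ differentiable (gradient I) t,
      forall i j, mu.-integrable C (fun u => (hessian (q ^~ u) t i j)%:E) &
      hessian I t = \matrix_(i, j) \int[mu]_(u in C) hessian (q ^~ u) t i j].

End differentiation_under_integral.

Section densities.
Variables (R : realType) (m : nat).
Implicit Types (rho : 'rV[R]_m -> R).

Definition is_density rho :=
  [/\ measurable_fun [set: borel_rV R m] rho, forall u, 0 <= rho u &
      (\int[lebesgue_rV R m]_u (rho u)%:E = 1)%E].

Definition dens_E rho (g : 'rV[R]_m -> R) : R :=
  \int[lebesgue_rV R m]_u (g u * rho u).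

Definition dens_Emx rho k l (G : 'rV[R]_m -> 'M[R]_(k, l)) : 'M[R]_(k, l) :=
  \matrix_(i, j) dens_E rho (fun u => G u i j).

(** [X] is a row vector, so that the outer product is [X^T *m X]. *)
Definition dens_Cov rho k (X : 'rV[R]_m -> 'rV[R]_k) : 'M[R]_k :=
  dens_Emx rho (fun u => (X u - dens_Emx rho X)^T *m (X u - dens_Emx rho X)).

(** Without it the integral defining [dens_Cov rho X] may diverge, and
    [Rintegral] then returns a default value. *)
Definition finite_second_moment rho k (X : 'rV[R]_m -> 'rV[R]_k) :=
  forall i, (lebesgue_rV R m).-integrable [set: borel_rV R m]
    (fun u => (X u 0 i ^+ 2 * rho u)%:E).

End densities.

Section gibbs.
Variables (R : realType) (m p : nat) (C : set 'rV[R]_m) (f0 : 'rV[R]_m -> R).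
Variables (tau : R) (dens : 'rV[R]_p -> 'rV[R]_m -> R).

Definition gibbs_integrand (t : 'rV[R]_p) (u : 'rV[R]_m) : R :=
  dens t u * expR (- f0 u / tau).

Definition partition_fun (t : 'rV[R]_p) : R :=
  \int[lebesgue_rV R m]_(u in (C : set (borel_rV R m))) gibbs_integrand t u.

Definition free_energy (t : 'rV[R]_p) : R := - tau * ln (partition_fun t).

Definition gibbs_tilt (t : 'rV[R]_p) (u : 'rV[R]_m) : R :=
  dens t u * expR (- f0 u / tau) * \1_C u / partition_fun t.

Definition gibbs_weight (u : 'rV[R]_m) : R := expR (- f0 u / tau) * \1_C u.

Definition score (t : 'rV[R]_p) (u : 'rV[R]_m) : 'rV[R]_p :=
  gradient (fun s => ln (dens s u)) t.

Definition log_hessian (t : 'rV[R]_p) (u : 'rV[R]_m) : 'M[R]_p :=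
  hessian (fun s => ln (dens s u)) t.

End gibbs.

(* Main.v *)
Require Import Defs.
From HB Require Import structures.
From mathcomp Require Import all_boot all_order all_algebra.
From mathcomp Require Import all_classical all_reals all_analysis.
From mathcomp Require Import measurable_realfun ring lra.

(** Write [q_t(u) = dens t u * exp (- f0 u / tau)], so that [Z] is the integral
    of [q] over [C], the tilt is [rho_t = q_t 1_C / Z t], and
    [F = - tau ln Z].  Both formulas come from one identity, applied twice.
    For a positive function [f] that is twice differentiable,
    [grad (ln f) = grad f / f] and
    [hess (ln f) = hess f / f - (grad (ln f))^T (grad (ln f))]
    ([gradient_ln], [hessian_ln]).

    Applied to [t |-> dens t u] it expresses the derivatives of [q] through
    the score [S] and the log-Hessian [L]: the factor [exp (- f0 u / tau)] is
    constant in [t], hence [grad q = q S] and [hess q = q (L + S^T S)]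
    ([gibbs_integrand_score]).  Differentiation under the integral sign
    followed by division by [Z] turns these into the moments [grad Z / Z = E_rho S] and
    [hess Z / Z = E_rho (L + S^T S)].

    Applied to [Z] it gives [grad (ln Z) = E_rho S], which is the gradient
    formula, and [hess (ln Z) = E_rho (L + S^T S) - (E_rho S)^T (E_rho S)].
    The last expression is [E_rho L + Cov_rho S] by the usual formula for the
    covariance ([dens_CovE]), once the expectation of the sum is split.  This
    splitting is where integrability matters: [L + S^T S] is integrable
    against [rho] because [hess q] is integrable, and the finite second moment
    of the score makes [S^T S], hence also [L], integrable
    ([integrable_cross]).

    The positivity of [Z] is not automatic, since a nonempty compact set may
    be Lebesgue-null.  When it is, [Z] vanishes on [Theta], and the
    conventions [ln 0 = 0] and [0^-1 = 0] make [F] and [rho] vanish, and with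
    them both sides of every formula.  Otherwise [Z] is positive, as the
    integral of a positive function over a set of nonzero measure
    ([Rintegral_gt0]); the integrand is integrable because [f0] is bounded
    below on [C] ([integrable_gibbs_integrand]). *)

Set Implicit Arguments.
Unset Strict Implicit.
Unset Printing Implicit Defensive.

Import Order.TTheory GRing.Theory Num.Theory.
Import numFieldNormedType.Exports.

Local Open Scope classical_set_scope.
Local Open Scope ring_scope.

(** * Gradients and Hessians of multiples and logarithms *)

(** The closed forms of the gradients of [F] and of [ln f] hold only near the
    point considered, where positivity and differentiability are available;
    this transfers differentiability from the closed form. *)
Lemma near_eq_differentiable (R : numFieldType) (V W : normedModType R)
    (f g : V -> W) (a : V) :
  {near a, f =1 g} -> differentiable f a -> differentiable g a.
Proof.
move=> fg df.
have E : g \o shift a = cst (g a) + 'd f a +o_ (0 : V) id.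
  apply/eqaddoP => eps e0.
  have /diff_locallyP[_ /eqaddoE/eqaddoP/(_ _ e0)] := df.
  have : \forall h \near (0 : V), f (h + a) = g (h + a).
    by have := fg; rewrite (near_shift 0)/= subr0.
  apply: filterS2 => h fgh /=.
  rewrite -[X in _ -> `|X| <= _]/(g (h + a) - (g a + 'd f a h)).
  rewrite -[X in `|X| <= _ -> _]/(f (h + a) - (f a + 'd f a h)).
  by rewrite fgh (nbhs_singleton fg).
have dE : 'd g a = 'd f a :> (V -> W).
  by apply: diff_unique => //; exact: diff_continuous.
by apply/diff_locallyP; rewrite dE; split => //; exact: diff_continuous.
Qed.

Section calculus.
Variables (R : realType) (p : nat).
Implicit Types (f g : 'rV[R]_p -> R) (t : 'rV[R]_p).

Lemma gradient_near_eq f g t : {near t, f =1 g} -> gradient f t = gradient g t.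
Proof. by move=> fg; apply/rowP => i; rewrite !mxE; exact: near_eq_derive. Qed.

Lemma hessian_near_eq f g t : {near t, f =1 g} -> hessian f t = hessian g t.
Proof.
move=> fg; apply/matrixP => i j; rewrite !mxE; apply: near_eq_derive.
have /= := near_join fg; apply: filterS => s fgs.
exact: near_eq_derive.
Qed.

Lemma gradientZ (c : R) f t :
  differentiable f t -> gradient (c \*: f) t = c *: gradient f t.
Proof.
by move=> df; apply/rowP => i; rewrite !mxE deriveZ//; exact: diff_derivable.
Qed.

Lemma differentiable_row n (G : 'rV[R]_p -> 'rV[R]_n) t :
  (forall j, differentiable (fun s => G s 0 j : R) t) -> differentiable G t.
Proof.
move=> dG.
rewrite (_ : G = \sum_(j < n) fun s => G s 0 j *: delta_mx 0 j).
  by apply: differentiable_sum => j; exact/differentiableZl/dG.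
by apply/funext => s; rewrite fct_sumE -row_sum_delta.
Qed.

Lemma differentiable_partial f t (j : 'I_p) :
  differentiable (gradient f) t -> differentiable ('D_(delta_mx 0 j) f) t.
Proof.
move=> df.
rewrite (_ : 'D_(delta_mx 0 j) f = (fun v : 'rV_p => v 0 j) \o gradient f).
  by apply: differentiable_comp => //; exact: differentiable_coord.
by apply/funext => s; rewrite /= mxE.
Qed.

Lemma hessianZ (c : R) f t : (\near t, differentiable f t) ->
  differentiable (gradient f) t -> hessian (c \*: f) t = c *: hessian f t.
Proof.
move=> df dgf; apply/matrixP => i j; rewrite !mxE.
rewrite -[RHS]/(_ *: _) -deriveZ; last first.
  exact/diff_derivable/differentiable_partial.
apply: near_eq_derive; apply: filterS df => s df.
by rewrite deriveZ//; exact: diff_derivable.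
Qed.

Lemma gradient_ln f t : differentiable f t -> 0 < f t ->
  gradient (fun s => ln (f s)) t = (f t)^-1 *: gradient f t.
Proof.
move=> df ft0; apply/rowP => i; rewrite !mxE.
have [dln lnE] := is_derive1_ln ft0.
have dl : differentiable (@ln R) (f t) by exact/derivable1_diffP.
rewrite deriveE; last exact: (differentiable_comp df dl).
by rewrite (diff_comp df dl) /= deriv1E// derive1E lnE -deriveE// mulrC.
Qed.

Lemma differentiable_ln f t : differentiable f t -> 0 < f t ->
  differentiable (fun s => ln (f s)) t.
Proof.
move=> df ft0; have [dln _] := is_derive1_ln ft0.
by apply: (differentiable_comp df); exact/derivable1_diffP.
Qed.

(** Near [t] the partial derivatives of [ln f] are those of [f] divided by [f];
    the product rule applied to these quotients gives the Hessian, and the term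
    [- f^-2 (grad f)^T (grad f)] coming from [f^-1] is minus the square of the
    logarithmic gradient. *)
Lemma hessian_ln f t : (\near t, differentiable f t /\ 0 < f t) ->
  differentiable (gradient f) t ->
  differentiable (gradient (fun s => ln (f s))) t /\
  hessian (fun s => ln (f s)) t = (f t)^-1 *: hessian f t -
    (gradient (fun s => ln (f s)) t)^T *m gradient (fun s => ln (f s)) t.
Proof.
move=> nf dgf; have [df ft0] := nbhs_singleton nf.
have fn0 : f t != 0 by rewrite gt_eqF.
have partialE j : \forall s \near t,
    (f s)^-1 * 'D_(delta_mx 0 j) f s = 'D_(delta_mx 0 j) (fun s => ln (f s)) s.
  apply: filterS nf => s [dfs fs0].
  by have /rowP/(_ j) := gradient_ln dfs fs0; rewrite !mxE.
have dV : differentiable (fun s => (f s)^-1) t by exact: differentiableV.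
split.
  apply: differentiable_row => j.
  under eq_fun do rewrite mxE.
  apply: near_eq_differentiable (partialE j) _.
  by apply: differentiableM => //; exact: differentiable_partial.
apply/matrixP => i j; rewrite gradient_ln// !mxE big_ord1 !mxE.
rewrite -(near_eq_derive _ (partialE j)).
rewrite (@deriveM _ _ (fun s => (f s)^-1)); [|exact: diff_derivable|].
  rewrite deriveV//; last exact: diff_derivable.
  by rewrite -![_ *: _]/(_ * _); field; rewrite fn0.
exact/diff_derivable/differentiable_partial.
Qed.

End calculus.

(** * Integrability and positivity of integrals *)

Section integration.
Variables (d : measure_display) (T : measurableType d) (R : realType).
Variables (mu : {measure set T -> \bar R}) (D : set T) (mD : measurable D).

Lemma Rintegral_gt0 (f : T -> R) :
  mu.-integrable D (EFin \o f) -> (forall x, D x -> 0 < f x) -> mu D <> 0%E ->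
  0 < \int[mu]_(x in D) f x.
Proof.
move=> intf f0 muD; rewrite lt_neqAle; apply/andP; split; last first.
  by apply: Rintegral_ge0 => x /f0/ltW.
apply/eqP => /esym if0; apply: muD.
have mf := measurable_int mu intf.
have : (\int[mu]_(x in D) `|(f x)%:E| = 0)%E.
  rewrite -[RHS](congr1 EFin if0) fineK; last exact: integrable_fin_num.
  apply: eq_integral => x; rewrite inE => Dx.
  by rewrite gee0_abs// lee_fin ltW// f0.
move/(ae_eq_integral_abs mu mD mf) => [N [mN N0 DN]].
apply/eqP; rewrite -measure_le0 -N0 le_measure ?inE// => x Dx; apply: DN => /=.
by move/(_ Dx)/eqP; rewrite /= eqe gt_eqF// f0.
Qed.

(** Cross moments are dominated by second moments: [2 |a b| <= a^2 + b^2].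
    Only the products [a q] and [b q] are assumed measurable, as these are the
    derivatives of an integrand; [a b q = (a q) (b q) / q] is then measurable
    because [q] is positive. *)
Lemma integrable_cross (q a b : T -> R) : (forall x, D x -> 0 < q x) ->
  measurable_fun D q ->
  measurable_fun D (fun x => a x * q x) ->
  measurable_fun D (fun x => b x * q x) ->
  mu.-integrable D (fun x => (a x ^+ 2 * q x)%:E) ->
  mu.-integrable D (fun x => (b x ^+ 2 * q x)%:E) ->
  mu.-integrable D (fun x => (a x * b x * q x)%:E).
Proof.
move=> q0 mq ma mb ia ib.
apply: le_integrable (integrableD mD ia ib) => //.
  apply/measurable_EFinP.
  (* [expR (- ln q)] is [q^-1], in a form built from measurable functions. *)
  apply: (eq_measurable_fun
    (fun x => a x * q x * (b x * q x) * expR (- ln (q x)))).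
    move=> x; rewrite inE => Dx; rewrite expRN lnK ?posrE ?q0//.
    by field; rewrite gt_eqF ?q0.
  apply: measurable_funM; first exact: measurable_funM.
  apply: measurableT_comp => //; apply: measurableT_comp => //.
  exact: measurableT_comp.
move=> x Dx; have qx := q0 _ Dx.
rewrite /= lee_fin -!mulrDl !normrM (gtr0_norm qx) ler_pM2r//.
rewrite [leRHS]ger0_norm ?addr_ge0 ?sqr_ge0// -normrM ler_norml.
by apply/andP; split; nra.
Qed.

End integration.

(** * Moments under a density *)

Section moments.
Variables (R : realType) (m : nat).
Implicit Types (rho g h : 'rV[R]_m -> R).
Local Notation leb := (lebesgue_rV R m).
Local Notation dens_integrable rho g :=
  (leb.-integrable [set: borel_rV R m] (fun u => (g u * rho u)%:E)).

Lemma dens_EB rho g h : dens_integrable rho g -> dens_integrable rho h ->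
  dens_E rho (fun u => g u - h u) = dens_E rho g - dens_E rho h.
Proof.
move=> ig ih; rewrite /dens_E -RintegralB//.
by apply: eq_Rintegral => u _; rewrite mulrBl.
Qed.

Lemma dens_CovE rho k (X : 'rV[R]_m -> 'rV[R]_k) :
  dens_integrable rho (fun=> 1) -> dens_E rho (fun=> 1) = 1 ->
  (forall i, dens_integrable rho (fun u => X u 0 i)) ->
  (forall i j, dens_integrable rho (fun u => X u 0 i * X u 0 j)) ->
  dens_Cov rho X = dens_Emx rho (fun u => (X u)^T *m X u) -
    (dens_Emx rho X)^T *m dens_Emx rho X.
Proof.
move=> i1 E1 iX iXX; apply/matrixP => i j; rewrite !mxE big_ord1 !mxE.
set a := dens_E rho (fun u => X u 0 i); set b := dens_E rho (fun u => X u 0 j).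
have iZ c g : dens_integrable rho g -> dens_integrable rho (fun u => c * g u).
  move=> ig; apply: eq_integrable (integrableZl measurableT c ig) => //= u _.
  by rewrite -EFinM mulrA.
have EZ c g : dens_integrable rho g ->
    dens_E rho (fun u => c * g u) = c * dens_E rho g.
  move=> ig; rewrite /dens_E -RintegralZl//.
  by apply: eq_Rintegral => u _; rewrite mulrA.
have iB g h : dens_integrable rho g -> dens_integrable rho h ->
    dens_integrable rho (fun u => g u - h u).
  move=> ig ih; apply: eq_integrable (integrableB measurableT ig ih) => //= u _.
  by rewrite -EFinB mulrBl.
transitivity (dens_E rho (fun u => (X u 0 i * X u 0 j - b * X u 0 i) -
   (a * X u 0 j - a * b * 1))).
  apply: eq_Rintegral => u _; congr (_ * _).
  by rewrite !mxE big_ord1 !mxE -/a -/b; ring.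
rewrite !dens_EB ?EZ//; do ?[exact: iB|exact: iZ].
- rewrite E1 -/a -/b.
  rewrite (_ : dens_E rho (fun u => ((X u)^T *m X u) i j) =
    dens_E rho (fun u => X u 0 i * X u 0 j)); first by ring.
  by apply: eq_Rintegral => u _; rewrite !mxE big_ord1 !mxE.
- by apply: iB; [exact: iXX|exact: iZ].
- by apply: iB; exact: iZ.
Qed.

End moments.

(** * The truncated Gibbs tilt *)

Lemma within_continuous_measurable_rV (R : realType) (m : nat)
    (C : set 'rV[R]_m) (f : 'rV[R]_m -> R) :
  compact C -> {within C, continuous f} ->
  measurable_fun (C : set (borel_rV R m)) f.
Proof.
move=> cC /continuousP cf; apply: (measurability _ (RGenOpens.measurableE R)).
move=> _ [_ [a [b ->] <-]].
have /cf/open_subspaceP[V oV] : open `]a, b[%classic by exact: interval_open.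
rewrite ![_ `&` C]setIC => <-.
by apply: measurableI; [exact: compact_measurable_rV|exact: open_measurable_rV].
Qed.

Section tilt.
Variables (R : realType) (m p : nat) (C : set 'rV[R]_m) (f0 : 'rV[R]_m -> R).
Variables (tau : R) (dens : 'rV[R]_p -> 'rV[R]_m -> R) (t : 'rV[R]_p).
Hypotheses (cC : compact C) (cf0 : {within C, continuous f0}).
Local Notation leb := (lebesgue_rV R m).
Local Notation q := (gibbs_integrand f0 tau dens t).
Local Notation Z := (partition_fun C f0 tau dens t).
Local Notation rho := (gibbs_tilt C f0 tau dens t).

Let mC : measurable (C : set (borel_rV R m)) := compact_measurable_rV cC.

Lemma gibbs_tiltE u : rho u = Z^-1 * (q \_ C) u.
Proof.
rewrite /gibbs_tilt /gibbs_integrand patchE indicE.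
by case: ifPn; rewrite ?mulr1 ?mulr0 ?mul0r // mulrC.
Qed.

Lemma integrable_tilt (g : 'rV[R]_m -> R) : Z != 0 ->
  leb.-integrable (C : set (borel_rV R m)) (fun u => (g u * q u)%:E) <->
  leb.-integrable [set: borel_rV R m] (fun u => (g u * rho u)%:E).
Proof.
move=> Z0; split=> ig.
  have /integrable_mkcond := integrableZl mC Z^-1 ig.
  move=> /(_ mC); apply: eq_integrable => //= u _.
  rewrite gibbs_tiltE !patchE; case: ifPn => _; rewrite ?mulr0//.
  by rewrite -EFinM mulrCA.
have := integrableS measurableT mC (@subsetT _ _) ig.
move=> /(integrableZl mC Z); apply: eq_integrable => //= u uC.
by rewrite gibbs_tiltE patchE uC -EFinM mulrCA mulVKf.
Qed.

Lemma dens_E_tilt (g : 'rV[R]_m -> R) :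
  leb.-integrable (C : set (borel_rV R m)) (fun u => (g u * q u)%:E) ->
  dens_E rho g = Z^-1 * \int[leb]_(u in (C : set (borel_rV R m))) (g u * q u).
Proof.
move=> ig; rewrite -RintegralZl// Rintegral_mkcond.
apply: eq_Rintegral => u _; rewrite gibbs_tiltE !patchE.
by case: ifPn => _; rewrite ?mulr0// mulrCA.
Qed.

Lemma dens_E_weight (g : 'rV[R]_m -> R) :
  dens_E (dens t) (fun u => gibbs_weight C f0 tau u * g u) =
  \int[leb]_(u in (C : set (borel_rV R m))) (g u * q u).
Proof.
rewrite Rintegral_mkcond; apply: eq_Rintegral => u _.
rewrite /gibbs_weight patchE indicE /gibbs_integrand.
by case: ifPn => _ /=; rewrite ?mulr0 ?mul0r//; ring.
Qed.

(** [f0] attains its minimum on the compact set [C], so on [C] the integrand is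
    at most a constant times the density. *)
Lemma integrable_gibbs_integrand : C !=set0 -> 0 < tau -> is_density (dens t) ->
  leb.-integrable (C : set (borel_rV R m)) (EFin \o q).
Proof.
move=> C0 tau0 [md d0 d1].
have [c _ fc] := EVT_min_rV C0 cC cf0.
have id : leb.-integrable [set: borel_rV R m] (EFin \o dens t).
  apply/integrableP; split; first exact/measurable_EFinP.
  under eq_integral => u _ do rewrite /= ger0_norm//.
  by rewrite d1 ltry.
have idC := integrableS measurableT mC (@subsetT _ _) id.
apply: le_integrable (integrableZl mC (expR (- f0 c / tau)) idC) => //.
  apply/measurable_EFinP; apply: measurable_funM; first exact: measurable_funTS.
  apply: measurableT_comp => //; apply: measurable_funM => //.
  by apply: measurableT_comp => //; exact: within_continuous_measurable_rV.
move=> u Cu; rewrite -EFinM /= lee_fin !normrM mulrC ler_wpM2r//.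
rewrite !ger0_norm ?expR_ge0// ler_expR ler_pM2r ?invr_gt0// lerN2.
by apply: fc; rewrite inE.
Qed.

End tilt.

(** The Gibbs factor does not depend on the parameter, so it cancels in
    [grad q / q] and [hess q / q], which are thus those of the density alone. *)
Lemma gibbs_integrand_score (R : realType) (m p : nat)
    (f0 : 'rV[R]_m -> R) (tau : R) (U : set 'rV[R]_p) (dens : 'rV[R]_p -> 'rV[R]_m -> R) t u :
  open U -> U t -> C2_on U (dens ^~ u) -> (forall s, U s -> 0 < dens s u) ->
  let q := gibbs_integrand f0 tau dens in
  let S := score dens t u in
  gradient (q ^~ u) t = q t u *: S /\
  hessian (q ^~ u) t = q t u *: (log_hessian dens t u + S^T *m S).
Proof.
move=> oU Ut C2 pos /=.
have [df dgf _] := C2 _ Ut.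
have ft0 := pos _ Ut; have fn0 : dens t u != 0 by rewrite gt_eqF.
have nearU : \near t, differentiable (dens ^~ u) t /\ 0 < dens t u.
  have : nbhs t U by exact: open_nbhs_nbhs.
  by apply: filterS => s Us; split; [have [] := C2 _ Us|exact: pos].
pose c := expR (- f0 u / tau).
have qE : (gibbs_integrand f0 tau dens) ^~ u = c \*: (dens ^~ u).
  by apply/funext => s; rewrite /gibbs_integrand mulrC.
have cE : gibbs_integrand f0 tau dens t u = c * dens t u by rewrite mulrC.
have [_ hE] := hessian_ln nearU dgf.
rewrite qE cE; split.
  by rewrite gradientZ// /score gradient_ln// scalerA mulrK ?unitfE.
rewrite hessianZ//; last by apply: filterS nearU => s [].
by rewrite /log_hessian hE subrK scalerA mulrK ?unitfE.
Qed.

(** * Derivatives of the free energy *)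

Theorem lemma1 (R : realType) (m p : nat)
    (C : set 'rV[R]_m) (f0 : 'rV[R]_m -> R) (tau : R)
    (Theta : set 'rV[R]_p) (dens : 'rV[R]_p -> 'rV[R]_m -> R)
    (C_nonempty : C !=set0) (C_compact : compact C)
    (f0_continuous : {within C, continuous f0}) (tau_gt0 : 0 < tau)
    (dens_density : forall t, Theta t -> is_density (dens t))
    (dens_gt0 : forall t u, Theta t -> C u -> 0 < dens t u)
    (dens_C2 : forall u, C u -> C2_on Theta° (dens ^~ u))
    (under1 : diff_under_integral1 (lebesgue_rV R m) C
                (gibbs_integrand f0 tau dens) Theta°)
    (under2 : diff_under_integral2 (lebesgue_rV R m) C
                (gibbs_integrand f0 tau dens) Theta°) :
  let F := free_energy C f0 tau dens in
  let rho := gibbs_tilt C f0 tau dens in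
  let w := gibbs_weight C f0 tau in
  forall t, Theta° t ->
  [/\ differentiable F t,
      gradient F t = - tau *: dens_Emx (rho t) (score dens t) &
      gradient F t = - tau *:
        ((dens_E (dens t) w)^-1 *:
           dens_Emx (dens t) (fun u => w u *: score dens t u))] /\
  differentiable (gradient F) t /\
  (finite_second_moment (rho t) (score dens t) ->
   hessian F t = - tau *: (dens_Emx (rho t) (log_hessian dens t) +
                           dens_Cov (rho t) (score dens t))).
Proof.
move=> F rho w t Ut.
pose q := gibbs_integrand f0 tau dens.
pose Z := partition_fun C f0 tau dens.
pose S := score dens t; pose L := log_hessian dens t.
have oU : open Theta° by exact: open_interior.
have mC := compact_measurable_rV C_compact.
have nearU : nbhs t Theta° by exact: open_nbhs_nbhs.
have iq s : Theta s ->
    (lebesgue_rV R m).-integrable (C : set (borel_rV R m)) (EFin \o q s).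
  by move=> Ts; apply: integrable_gibbs_integrand => //; exact: dens_density.
have q0 s u : Theta s -> C u -> 0 < q s u.
  by move=> Ts Cu; rewrite mulr_gt0 ?expR_gt0// dens_gt0.
have wZ : dens_E (dens t) w = Z t.
  transitivity (dens_E (dens t) (fun u => w u * 1)).
    by apply: eq_Rintegral => u _; rewrite mulr1.
  by rewrite dens_E_weight; apply: eq_Rintegral => u _; rewrite mul1r.
have qS u : C u -> gradient (q ^~ u) t = q t u *: S u /\
    hessian (q ^~ u) t = q t u *: (L u + (S u)^T *m S u).
  move=> Cu; apply: (@gibbs_integrand_score _ _ _ _ _ Theta°) => //.
    exact: dens_C2.
  by move=> s /interior_subset Ts; exact: dens_gt0.
have [dZ idq gZ] := under1 _ Ut.
have [dgZ ihq hZ] := under2 _ Ut.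
(* If [C] is Lebesgue-null, all the quantities below are 0 near [t]. *)
have [C0|C0] := pselect (lebesgue_rV R m C = 0%E).
  have Z0 s : Theta s -> Z s = 0.
    move=> Ts; rewrite /Z /partition_fun /Rintegral null_set_integral//.
    exact: measurable_int (iq _ Ts).
  have F0 : {near t, F =1 cst 0}.
    apply: filterS nearU => s /interior_subset/Z0.
    by rewrite /F /free_energy /Z => ->; rewrite ln0// mulr0.
  have F0' : {near t, cst 0 =1 F} by apply: filterS F0 => s ->.
  have g0 s : gradient (cst 0 : 'rV[R]_p -> R) s = 0.
    by apply/rowP => i; rewrite !mxE derive_cst.
  have rho0 u : rho t u = 0.
    by rewrite /rho gibbs_tiltE -/Z Z0 ?invr0 ?mul0r//; exact: interior_subset.
  have E0 k l (G : 'rV[R]_m -> 'M[R]_(k, l)) : dens_Emx (rho t) G = 0.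
    apply/matrixP => i j; rewrite !mxE /dens_E.
    under eq_Rintegral do rewrite rho0 mulr0.
    by rewrite Rintegral_cst// mul0r.
  have gF0 : gradient F t = 0 by rewrite (gradient_near_eq F0) g0.
  split; first split.
  - exact: near_eq_differentiable F0' (differentiable_cst _ _).
  - by rewrite gF0 E0 scaler0.
  - by rewrite gF0 wZ Z0 ?invr0 ?scale0r ?scaler0//; exact: interior_subset.
  split.
    apply: (@near_eq_differentiable _ _ _ (cst 0)); last first.
      exact: differentiable_cst.
    have /= := near_join F0; apply: filterS => s F0s.
    by rewrite (gradient_near_eq F0s) g0.
  move=> _; rewrite (hessian_near_eq F0) /dens_Cov !E0 addr0 scaler0.
  apply/matrixP => i j; rewrite !mxE.
  rewrite (_ : 'D__ _ = cst 0) ?derive_cst//.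
  by apply/funext => s; rewrite derive_cst.
have Zpos s : Theta° s -> 0 < Z s.
  move=> /interior_subset Ts; apply: Rintegral_gt0 => //; first exact: iq.
  by move=> u Cu; exact: q0.
have Zt0 := Zpos _ Ut; have Zn0 : Z t != 0 by rewrite gt_eqF.
have nearZ : \near t, differentiable Z t /\ 0 < Z t.
  by apply: filterS nearU => s Us; split; [have [] := under1 _ Us|exact: Zpos].
have FE : F = - tau \*: (fun s => ln (Z s)) by [].
have dlnZ := differentiable_ln dZ Zt0.
have [dglnZ hlnZ] := hessian_ln nearZ dgZ.
have iS i : (lebesgue_rV R m).-integrable (C : set (borel_rV R m))
    (fun u => (S u 0 i * q t u)%:E).
  apply: eq_integrable (idq i) => // u; rewrite inE => Cu.
  by have [-> _] := qS _ Cu; rewrite mxE mulrC.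
have ES : dens_Emx (rho t) S = gradient (fun s => ln (Z s)) t.
  rewrite gradient_ln// gZ; apply/rowP => i.
  rewrite !mxE dens_E_tilt//; congr (_ * _).
  apply: eq_Rintegral => u; rewrite inE => Cu.
  by have [-> _] := qS _ Cu; rewrite [RHS]mxE mulrC.
have gF : gradient F t = - tau *: dens_Emx (rho t) S.
  by rewrite FE gradientZ// ES.
split; first split.
- by rewrite FE; exact: differentiableZ.
- exact: gF.
- rewrite gF wZ; congr (_ *: _); apply/rowP => i.
  rewrite !mxE dens_E_tilt// -dens_E_weight; congr (_ * _).
  by apply: eq_Rintegral => u _; rewrite [X in _ = X * _]mxE.
split.
  apply: (@near_eq_differentiable _ _ _
      (- tau \*: gradient (fun s => ln (Z s)))); last exact: differentiableZ.
  apply: filterS nearZ => s [dZs Zs0].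
  by rewrite FE gradientZ//; exact: differentiable_ln.
move=> fin.
have Tt := interior_subset Ut.
have iSS i j : (lebesgue_rV R m).-integrable (C : set (borel_rV R m))
    (fun u => (S u 0 i * S u 0 j * q t u)%:E).
  have mS k := (measurable_EFinP _ _).1 (measurable_int _ (iS k)).
  have iS2 k : (lebesgue_rV R m).-integrable (C : set (borel_rV R m))
      (fun u => (S u 0 k ^+ 2 * q t u)%:E).
    by apply/integrable_tilt => //; exact: fin.
  apply: integrable_cross => //.
    by move=> u Cu; exact: q0.
  by apply/measurable_EFinP; exact: measurable_int (iq _ Tt).
have iH i j : (lebesgue_rV R m).-integrable (C : set (borel_rV R m))
    (fun u => ((L u i j + S u 0 i * S u 0 j) * q t u)%:E).
  apply: eq_integrable (ihq i j) => // u; rewrite inE => Cu.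
  by have [_ ->] := qS _ Cu; rewrite !mxE big_ord1 !mxE mulrC.
(* [E_rho L] is [E_rho (L + S^T S) - E_rho (S^T S)], rather than the sum being
   split, because [L + S^T S] is what [hess q] shows to be integrable. *)
have EH : dens_Emx (rho t) L =
    (Z t)^-1 *: hessian Z t - dens_Emx (rho t) (fun u => (S u)^T *m S u).
  rewrite hZ; apply/matrixP => i j; rewrite !mxE.
  transitivity (dens_E (rho t)
    (fun u => (L u i j + S u 0 i * S u 0 j) - S u 0 i * S u 0 j)).
    by apply: eq_Rintegral => u _; rewrite addrK.
  rewrite dens_EB; [|exact/integrable_tilt|exact/integrable_tilt].
  congr (_ - _).
    rewrite dens_E_tilt//; congr (_ * _); apply: eq_Rintegral => u.
    rewrite inE => Cu; have [_ ->] := qS _ Cu.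
    by rewrite !mxE big_ord1 !mxE mulrC.
  by apply: eq_Rintegral => u _; rewrite !mxE big_ord1 !mxE.
have i1 : (lebesgue_rV R m).-integrable (C : set (borel_rV R m))
    (fun u => (1 * q t u)%:E).
  by apply: eq_integrable (iq _ Tt) => // u _; rewrite /= mul1r.
have E1 : dens_E (rho t) (fun=> 1) = 1.
  rewrite dens_E_tilt//.
  under eq_Rintegral do rewrite mul1r.
  exact: mulVf.
rewrite dens_CovE//; first last.
- by move=> i j; exact/integrable_tilt.
- by move=> i; exact/integrable_tilt.
- exact/integrable_tilt.
rewrite EH addrA subrK ES -hlnZ FE hessianZ//.
by apply: filterS nearZ => s [dZs Zs0]; exact: differentiable_ln.
Qed.
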